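(* Let $n$ be a positive integer, let $S\subseteq\{1,\dots,n-1\}$ be closed under taking additive inverses modulo $n$, let $G=\operatorname{Circ}(n,S)$, let $\omega=e^{2\pi i/n}$, and let $k$ be a nonnegative integer. The following are equivalent. (1) There exists a positive semidefinite Hermitian circulant matrix with rank $k$ and graph $G$. (2) There exists a cyclically symmetric orthogonal representation for $G$ over $\mathbb C$ with rank $k$. (3) There exists a polynomial $p\in\mathbb R_{\ge 0}[z]$ whose normalized coefficient vector has support of size $k$ such that $$p(\omega^j)=0 \iff j\notin S\quad\text{for all } j\in\{1,2,\dots,n-1\}.$$ (4) There exists a polynomial $p\in\mathbb R_{\ge 0}[z]$ of degree at most $n-1$ with exactly $k$ terms such that $$p(\omega^j)=0 \iff j\notin S\quad\text{for all } j\in\{1,2,\dots,n-1\}.$$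
   Context: Vectors and matrices are indexed from $0$. $\operatorname{Circ}(n,S)$ is the simple graph on vertex set $\{0,1,\dots,n-1\}$ in which $i,j$ are adjacent iff $(i-j)\bmod n\in S$. An $n\times n$ Hermitian matrix $A$ has graph $G$ (where $V(G)=\{0,\dots,n-1\}$) if for all $i\ne j$: $A_{ij}\neq 0$ iff $\{i,j\}\in E(G)$; diagonal entries are unrestricted. $A$ is a circulant matrix if $A_{ij}$ depends only on $i-j$ modulo $n$. An orthogonal representation for $G$ in $\mathbb C^d$ is a function $r:V(G)\to\mathbb C^d$ such that for distinct vertices $v,w$: $\langle r(v),r(w)\rangle\neq 0$ iff $\{v,w\}\in E(G)$. It is said to be over $\mathbb C$ (with $d$ arbitrary); its rank is the dimension of the span of its image. It is cyclically symmetric if there are a $d\times d$ unitary matrix $U$ with $U^n=I$ and $x\in\mathbb C^d$ such that $r(i)=U^i x$ for all $i\in\{0,\dots,n-1\}$. $\mathbb R_{\ge 0}[z]$ is the set of real polynomials with all coefficients nonnegative (including the zero polynomial, which has no terms and is regarded as having degree at most $n-1$). The terms of a polynomial are its monomials with nonzero coefficient. For $p=\sum_m a_m z^m\in\mathbb R_{\ge 0}[z]$, put $b_i=\sum_{m\equiv i \bmod n}a_m$ for $0\le i\le n-1$ (so $\sum_i b_i z^i$ is the unique polynomial of degree at most $n-1$ agreeing with $p$ at all complex $n$th roots of unity); the normalized coefficient vector of $p$ is $(\sqrt{b_0},\dots,\sqrt{b_{n-1}})\in\mathbb R^n$. The support of a vector is the set of indices of its nonzero coordinates. *)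

(* Defs.v *)
From HB Require Import structures.
From mathcomp Require Import all_boot all_order all_algebra.
From mathcomp Require Import complex.
From mathcomp Require Import reals trigo.

Set Implicit Arguments.
Unset Strict Implicit.
Unset Printing Implicit Defensive.

Import Order.TTheory GRing.Theory Num.Theory.

Local Open Scope ring_scope.
Local Open Scope complex_scope.
Local Open Scope sesquilinear_scope.

(* The residue (i - j) mod n; since j < n, the truncated n - j is exact. *)
Definition subm (n : nat) (i j : 'I_n) : nat := (i + (n - j)) %% n.

Definition circ (n : nat) (S : {pred nat}) : rel 'I_n :=
  fun i j => subm i j \in S.

Arguments circ : clear implicits.

Lemma circ_irr (n : nat) (S : {pred nat}) :
  (forall s : nat, s \in S -> (1 <= s <= n - 1)%N) ->
  irreflexive (circ n S).
Proof.
move=> hS i; apply/negbTE/negP => /hS.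
by rewrite /subm subnKC ?modnn // ltnW.
Qed.

Lemma circ_sym (n : nat) (S : {pred nat}) :
  (forall s : nat, s \in S -> (1 <= s <= n - 1)%N) ->
  (forall s : nat, s \in S -> ((n - s) %% n)%N \in S) ->
  symmetric (circ n S).
Proof.
move=> hS hN.
suff H i j : circ n S i j -> circ n S j i by move=> i j; apply/idP/idP => /H.
rewrite /circ => Hij; have /andP[s1 s2] := hS _ Hij.
suff -> : subm j i = ((n - subm i j) %% n)%N by exact: hN.
have lt_ij : (subm i j < n)%N by rewrite ltn_mod (leq_ltn_trans _ (ltn_ord i)).
apply/eqP; rewrite -[subm j i](modn_mod _ n) /subm modn_mod.
rewrite -(eqn_modDr (subm i j)) subnK ?(ltnW lt_ij) // modnn.
rewrite /subm modnDmr [(i + _)%N]addnC addnACA subnKC ?(ltnW (ltn_ord j)) //.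
by rewrite subnK ?(ltnW (ltn_ord i)) // modnDr modnn.
Qed.

Section Complex.
Variable R : realType.
Local Notation C := R[i].

Definition circulant (n : nat) (A : 'M[C]_n) : Prop :=
  forall i j k l : 'I_n, subm i j = subm k l -> A i j = A k l.

Definition has_graph (n : nat) (A : 'M[C]_n) (e : rel 'I_n) : Prop :=
  A \is hermsymmx /\ forall i j : 'I_n, i != j -> (A i j != 0) <-> e i j.

(* On R[i], 0 <= z means that z is real and nonnegative. *)
Definition psd (n : nat) (A : 'M[C]_n) : Prop :=
  A \is hermsymmx /\ forall x : 'cV[C]_n, 0 <= (x ^t* *m A *m x) 0 0.

(* dotmx is the standard Hermitian inner product on row vectors. *)
Definition orthorep (n d : nat) (e : rel 'I_n) (r : 'I_n -> 'cV[C]_d) : Prop :=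
  forall v w : 'I_n, v != w -> (dotmx (r v)^T (r w)^T != 0) <-> e v w.

Definition orthorep_rank (n d : nat) (r : 'I_n -> 'cV[C]_d) : nat :=
  \dim <<codom r>>%VS.

Definition cyclically_symmetric (n d : nat) (r : 'I_n -> 'cV[C]_d) : Prop :=
  exists (U : 'M[C]_d) (x : 'cV[C]_d),
    [/\ U \is unitarymx, U ^+ n = 1%:M & forall i : 'I_n, r i = U ^+ i *m x].

Definition omega (n : nat) : C :=
  cos (2 * pi / n%:R) +i* sin (2 * pi / n%:R).

Definition ceval (p : {poly R}) (z : C) : C := (map_poly (real_complex R) p).[z].

Definition normalized_coef (n : nat) (p : {poly R}) : 'rV[R]_n :=
  \row_(i < n) Num.sqrt (\sum_(m < size p | (m %% n)%N == i) p`_m).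

Definition support_size (n : nat) (v : 'rV[R]_n) : nat :=
  #|[set i : 'I_n | v 0 i != 0]|.

Definition nb_terms (p : {poly R}) : nat :=
  #|[set m : 'I_(size p) | p`_m != 0]|.

End Complex.

Arguments omega R n : clear implicits.

(* Main.v *)
Require Import Defs.
From HB Require Import structures.
From mathcomp Require Import all_boot all_order all_algebra.
From mathcomp Require Import complex.
From mathcomp Require Import reals trigo.
Import Order.TTheory GRing.Theory Num.Theory.
Local Open Scope ring_scope.
Local Open Scope sesquilinear_scope.

Set Implicit Arguments.
Unset Strict Implicit.
Unset Printing Implicit Defensive.

(** Circulant matrices are exactly the matrices diagonalized by the Fourier
    matrix [F = (w^(i j))], where [w] is a primitive [n]-th root of unity: they
    are the matrices [F D F^H], with [D] diagonal and [^H] the conjugate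
    transpose ([circulant_spectral]). Since [F F^H = n I], such a matrix is
    positive semidefinite exactly when the diagonal [d] of [D] is nonnegative,
    and its rank is the number of nonzero entries of [d]. Its entry [(i, j)] is
    [sum_m d_m w^(m (i - j))], that is, the value at [w^(i - j)] of the
    polynomial with coefficients [d_m]. Hence positive semidefinite circulant
    matrices correspond to polynomials of degree below [n] with nonnegative
    coefficients ([psd_circulant_polyP]); the rank corresponds to the number of
    terms, and the zero pattern of the matrix to the vanishing of the polynomial
    at the powers of [w] ([has_graph_ceval]).

    A polynomial of arbitrary degree can be reduced modulo [z^n - 1] without
    changing its values at the [n]-th roots of unity; for nonnegative
    coefficients no cancellation occurs, and the terms left are counted by the
    normalized coefficient vector ([ceval_fold], [support_fold]).

    Orthogonal representations are reached through their Gram matrices. A Gram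
    matrix is positive semidefinite, has the rank of the family of vectors, and
    has graph [G] exactly when the family represents [G]. If [r(i) = U^i x] with
    [U] unitary and [U^n = I], then [<r(i), r(j)>] depends only on [i - j] modulo
    [n], so the Gram matrix is circulant. Conversely, [F D F^H] with [d >= 0] is
    the Gram matrix of the rows of [F sqrt(D)], and these are the orbit of the
    vector [sqrt(d)] under the diagonal unitary [diag(w^m)]
    ([cyclic_gram_fourier_diag]). *)

(** * Ranks of diagonal and Gram matrices *)

Lemma rank_diag_mx (F : fieldType) n (d : 'rV[F]_n) :
  \rank (diag_mx d) = #|[set i | d 0 i != 0]|.
Proof.
rewrite -sum1dep_card big_mkcond; elim: n d => [|n IHn] d.
  by rewrite big_ord0 flatmx0 mxrank0.
pose a := d 0 0; pose d' : 'rV_n := \row_j d 0 (lift 0 j).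
have diagE : diag_mx d = block_mx a%:M 0 0 (diag_mx d') :> 'M_(1 + n).
  apply/matrixP=> i j; rewrite [RHS]mxE !mxE.
  case: splitP => i' i_i'; rewrite !mxE; case: splitP => j' j_j'; rewrite ?mxE.
  - have -> : i = 0 by apply: val_inj; rewrite /= i_i' ord1.
    by have -> : j = 0 by [apply: val_inj; rewrite /= j_j' ord1]; rewrite !ord1.
  - by rewrite -val_eqE /= i_i' j_j' ord1.
  - by rewrite -val_eqE /= i_i' j_j' ord1.
  have -> : i = lift 0 i' by apply: val_inj.
  have -> : j = lift 0 j' by apply: val_inj.
  by rewrite (inj_eq lift_inj).
have -> : \rank (diag_mx d) = (\rank (a%:M : 'M_1) + \rank (diag_mx d'))%N.
  by rewrite diagE; apply: (@rank_diag_block_mx F 1 1).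
rewrite IHn big_ord_recl; congr (_ + _)%N.
  rewrite -scalemx1 -/a; case: eqVneq => [->|a0]; first by rewrite scale0r mxrank0.
  by rewrite mxrank_scale_nz // mxrank1.
by apply: eq_bigr => i _; rewrite mxE.
Qed.

(** If [u Q Q^H = 0] then [u Q] has norm zero, so [Q] and [Q Q^H] have the same
    left kernel. *)
Lemma mxrank_gram (C : numClosedFieldType) m n (Q : 'M[C]_(m, n)) :
  \rank (Q *m Q^t*) = \rank Q.
Proof.
apply/eqP; rewrite eqn_leq mxrankM_maxl /=.
rewrite -(subKn (rank_leq_row Q)) -(subKn (rank_leq_row (Q *m Q^t*))).
rewrite leq_sub2l // -!mxrank_ker.
apply/mxrankS/row_subP => i; apply/sub_kermxP/eqP.
rewrite -(dnorm_eq0 (@dotmx C n)) /= dotmxE trmx_mul map_mxM mulmxA.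
by rewrite -[row i _ *m Q *m _]mulmxA -row_mul mulmx_ker row0 mul0mx mxE.
Qed.
Lemma psd_gram (R : realType) n d (Q : 'M[R[i]]_(n, d)) : psd (Q *m Q^t*).
Proof.
split.
  by apply/is_hermitianmxP; rewrite expr0 scale1r trmx_mul map_mxM trmxCK.
move=> x; rewrite mulmxA -mulmxA.
have -> : Q^t* *m x = (x^t* *m Q)^t* by rewrite trmx_mul map_mxM trmxCK.
by rewrite -dotmxE dnorm_ge0.
Qed.

(** * The Fourier matrix *)

Section Fourier.
Variables (C : numClosedFieldType) (n : nat) (w : C).
Hypothesis w_prim : n.-primitive_root w.

Definition fourier : 'M[C]_n := \matrix_(i, j) w ^+ (i * j).

Let n_neq0 : n%:R != 0 :> C.
Proof. exact: prim_root_natf_neq0 w_prim. Qed.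

(** A root of unity has norm 1, so its conjugate is its inverse; conjugates
    then replace negative powers in the rest of the file. *)
Lemma prim_root_mul_conj : w * w^* = 1.
Proof.
have n_gt0 := prim_order_gt0 w_prim.
rewrite -normCK; have: `|w| ^+ n = 1 by rewrite -normrX (prim_expr_order w_prim) normr1.
by move/eqP; rewrite pexpr_eq1 // => /eqP ->; rewrite expr1n.
Qed.

Lemma prim_rootX_sub j : (j <= n)%N -> w ^+ (n - j) = w^* ^+ j.
Proof.
move=> le_jn; rewrite -[LHS]mulr1 -(expr1n _ j) -prim_root_mul_conj exprMn.
by rewrite mulrA -exprD subnK // (prim_expr_order w_prim) mul1r.
Qed.

Lemma prim_rootX_subm (i j : 'I_n) : w ^+ subm i j = w ^+ i * w^* ^+ j.
Proof.
by rewrite (prim_expr_mod w_prim) exprD prim_rootX_sub // ltnW.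
Qed.

(** Conjugating a diagonal matrix by [F] samples the polynomial with
    coefficients [d] at the power of [w] given by the index difference. Both
    the circulant shape and the link with polynomials come from this formula. *)
Lemma fourier_diagE (d : 'rV[C]_n) (i j : 'I_n) :
  (fourier *m diag_mx d *m fourier^t*) i j = \sum_m d 0 m * w ^+ (m * subm i j).
Proof.
rewrite mxE; apply: eq_bigr => m _.
rewrite mul_mx_diag !mxE mulrAC [LHS]mulrC; congr (_ * _).
by rewrite rmorphXn /= [RHS]exprM exprAC prim_rootX_subm exprMn -!exprM.
Qed.

(** The case [d = 1] of [fourier_diagE]: off the diagonal, the entry is the
    geometric sum of the powers of an [n]-th root of unity [z] with [z <> 1]. *)
Lemma fourier_gram : fourier *m fourier^t* = n%:R%:M.
Proof.
apply/matrixP=> i j; have := fourier_diagE (const_mx 1) i j.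
rewrite diag_const_mx mulmx1 => ->; rewrite !mxE.
pose z := w ^+ subm i j.
rewrite (eq_bigr (fun m : 'I_n => z ^+ m)); last first.
  by move=> m _; rewrite mxE mul1r /z -exprM mulnC.
have [eq_ij|ne_ij] := eqVneq i j.
  rewrite mulr1n (eq_bigr (fun=> 1)) ?sumr_const ?card_ord // => m _.
  by rewrite /z eq_ij /subm subnKC ?modnn ?expr1n // ltnW.
have z1 : z - 1 != 0.
  rewrite /z prim_rootX_subm subr_eq0; apply: contra ne_ij => /eqP e.
  have := congr1 ( *%R^~ (w ^+ j)) e.
  rewrite -mulrA -exprMn [_^* * _]mulrC prim_root_mul_conj expr1n mulr1 mul1r.
  by move/eqP; rewrite (eq_prim_root_expr w_prim) !modn_small.
apply: (mulfI z1); rewrite -subrX1 mulr0n mulr0 /z exprAC.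
by rewrite (prim_expr_order w_prim) expr1n subrr.
Qed.

Lemma fourier_scaledK : fourier *m (n%:R^-1 *: fourier^t*) = 1%:M.
Proof. by rewrite -scalemxAr fourier_gram scale_scalar_mx mulVf. Qed.

Lemma fourier_gramC : fourier^t* *m fourier = n%:R%:M.
Proof.
have /mulmx1C := fourier_scaledK; rewrite -scalemxAl.
move/(congr1 ( *:%R n%:R)).
by rewrite scalerA divff // scale1r scale_scalar_mx mulr1.
Qed.

Lemma fourier_unit : fourier \in unitmx.
Proof. by have /mulmx1_unit[] := fourier_scaledK. Qed.

Lemma fourierC_unit : fourier^t* \in unitmx.
Proof. by rewrite map_unitmx unitmx_tr fourier_unit. Qed.

Lemma rank_fourier_diag (d : 'rV[C]_n) :
  \rank (fourier *m diag_mx d *m fourier^t*) = #|[set i | d 0 i != 0]|.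
Proof.
rewrite mxrankMfree ?row_free_unit ?fourierC_unit // -rank_diag_mx.
rewrite -mxrank_tr trmx_mul mxrankMfree ?mxrank_tr //.
by rewrite row_free_unit unitmx_tr fourier_unit.
Qed.
End Fourier.

(** * Circulant matrices and their eigenvalues *)

Section Circulant.
Variables (R : realType) (n : nat) (w : R[i]).
Hypothesis w_prim : n.-primitive_root w.
Local Notation C := R[i].
Local Notation F := (fourier n w).

Lemma circulant_fourier_diag (d : 'rV[C]_n) : circulant (F *m diag_mx d *m F^t*).
Proof. by move=> i j k l e; rewrite !(fourier_diagE w_prim) e. Qed.

(** With nonnegative eigenvalues, [F D F^H] factors through [sqrt(D)]. This gives
    positive semidefiniteness and, read by rows, an orthogonal representation. *)
Lemma fourier_diag_gram (d : 'rV[C]_n) : (forall m, 0 <= d 0 m) ->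
  let Q := F *m diag_mx (map_mx sqrtC d) in
  F *m diag_mx d *m F^t* = Q *m Q^t*.
Proof.
move=> d0 Q; rewrite /Q trmx_mul map_mxM mulmxA tr_diag_mx map_diag_mx.
rewrite -[F *m diag_mx _ *m diag_mx _]mulmxA mulmx_diag.
congr (_ *m diag_mx _ *m _); apply/rowP=> m; rewrite !mxE.
by rewrite [RHS]/= conj_Creal ?ger0_real ?sqrtC_ge0 // -expr2 sqrtCK.
Qed.

(** A circulant matrix is determined by its first column, and so is
    [F diag(d) F^H], whose first column is [F d]; hence it is enough to solve
    [F d = col 0 A], and [F] is invertible. *)
Lemma circulant_spectral (A : 'M[C]_n) : circulant A ->
  exists d, A = F *m diag_mx d *m F^t*.
Proof.
move=> circA; have n_gt0 := prim_order_gt0 w_prim.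
pose o := Ordinal n_gt0; exists (F^t* *m (n%:R^-1 *: col o A))^T.
have eqA : F *m (F^t* *m (n%:R^-1 *: col o A)) = col o A.
  rewrite mulmxA (fourier_gram w_prim) -scalemxAr mul_scalar_mx scalerA.
  by rewrite mulVf ?scale1r // (prim_root_natf_neq0 w_prim).
apply/matrixP=> i j; rewrite (fourier_diagE w_prim).
have lt_t : (subm i j < n)%N by rewrite ltn_mod.
have -> : A i j = A (Ordinal lt_t) o.
  by apply: circA; rewrite {2}/subm /= subn0 modnDr modn_small.
have /colP/(_ (Ordinal lt_t)) := eqA; rewrite [in RHS]mxE => <-.
by rewrite mxE; apply: eq_bigr => m _; rewrite !mxE mulrC mulnC.
Qed.

(** Testing the quadratic form of [A] on the [m]-th column of [F], which is an
    eigenvector, returns the eigenvalue [d_m] up to the positive factor [n^2]. *)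
Lemma psd_circulant_spectral (A : 'M[C]_n) : psd A -> circulant A ->
  exists2 d : 'rV[C]_n, (forall m, 0 <= d 0 m) & A = F *m diag_mx d *m F^t*.
Proof.
move=> [_ psdA] /circulant_spectral[d defA]; exists d => // m.
have := psdA (col m F).
rewrite defA -!mulmxA (_ : F^t* *m col m F = n%:R *: delta_mx m 0); last first.
  by rewrite colE mulmxA (fourier_gramC w_prim) mul_scalar_mx.
rewrite -!scalemxAr mul_diag_mx.
rewrite (_ : \matrix_(i, j) _ = d 0 m *: delta_mx m 0); last first.
  apply/colP=> i; rewrite !mxE eqxx andbT.
  by case: eqVneq => [->|_]; rewrite ?mulr0.
rewrite colE -!scalemxAr trmx_mul map_mxM -mulmxA [_ *m (F *m _)]mulmxA.
rewrite (fourier_gramC w_prim) mul_scalar_mx -scalemxAr trmx_delta map_delta_mx.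
rewrite mul_delta_mx !mxE !eqxx mulr1 mulrCA.
by rewrite pmulr_lge0 // mulr_gt0 // ltr0n (prim_order_gt0 w_prim).
Qed.

End Circulant.

(** * Gram matrices of orthogonal representations *)

Lemma dotmx_colE (C : numClosedFieldType) d (u v : 'cV[C]_d) :
  dotmx u^T v^T = (v^t* *m u) 0 0.
Proof. by rewrite dotmxE !mxE; apply: eq_bigr => i _; rewrite !mxE mulrC. Qed.

Section Gram.
Variables (R : realType) (n d : nat) (r : 'I_n -> 'cV[R[i]]_d).
Local Notation C := R[i].

Definition gram_mx : 'M[C]_n :=
  let Q := \matrix_i (r i)^T in Q *m Q^t*.

Lemma gram_mxE i j : gram_mx i j = dotmx (r i)^T (r j)^T.
Proof. by rewrite dotmxE !mxE; apply: eq_bigr => k _; rewrite !mxE. Qed.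

Lemma gram_mx_psd : psd gram_mx.
Proof. exact: psd_gram. Qed.

Import VectorInternalTheory.

(** The dimension of a span is the rank of the matrix whose rows are the
    coordinates of the spanning vectors. These coordinates are taken through
    an abstract linear bijection, here the matrix [L], which preserves rank. *)
Lemma orthorep_rankE : orthorep_rank r = \rank (\matrix_i (r i)^T).
Proof.
set Q := \matrix_i _.
pose L : 'M_(d, _) := lin1_mx (v2r \o trmx : 'rV[C]_d -> _).
have L_free : row_free L.
  apply/row_freeP; exists (lin1_mx (trmx \o r2v : _ -> 'rV[C]_d)).
  apply/row_matrixP=> i; rewrite row_mul !rowE.
  by rewrite !mul_rV_lin1 /= v2rK trmxK mulmx1.
have QLE i : row i (Q *m L) = v2r (r i) by rewrite row_mul rowK mul_rV_lin1 /= trmxK.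
rewrite -(mxrankMfree Q L_free) /orthorep_rank /dimv unlock_with genmxE.
apply/eqP; rewrite eqn_leq; apply/andP; split; apply/mxrankS/row_subP => i.
  rewrite rowK.
  have /codomP[j ->] : tnth (in_tuple (codom r)) i \in codom r by exact: mem_tnth.
  by rewrite -QLE row_sub.
have /tnthP[j rj] : r i \in in_tuple (codom r) by exact: codom_f.
by rewrite QLE rj -(rowK (fun k => v2r (tnth (in_tuple (codom r)) k))) row_sub.
Qed.

Lemma rank_gram_mx : \rank gram_mx = orthorep_rank r.
Proof. by rewrite mxrank_gram orthorep_rankE. Qed.

Lemma orthorep_gramP (e : rel 'I_n) : orthorep e r <-> has_graph gram_mx e.
Proof.
split=> [re|[_ Ae] i j]; last by rewrite -gram_mxE; exact: Ae.
by split=> [|i j]; [case: gram_mx_psd|rewrite gram_mxE; exact: re].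
Qed.

(** Unitarity moves the powers of [U] to one side: [<U^i x, U^j x>] equals
    [x^H U^(n - j) U^i x], and the exponent only matters modulo [n]. *)
Lemma circulant_gram_mx : cyclically_symmetric r -> circulant gram_mx.
Proof.
move=> [U [x [Uu Un rE]]] i j k l eq_ij.
have UX m : U ^+ m \is unitarymx.
  elim: m => [|m IHm]; first by apply/unitarymxP; rewrite trmx1 map_mx1 mulmx1.
  by rewrite exprS; exact: mul_unitarymx.
have UXC m : (m <= n)%N -> (U ^+ m)^t* = U ^+ (n - m).
  move=> le_mn; rewrite -[RHS]mulmx1 -(unitarymxP (UX m)) mulmxA.
  by rewrite -[_ *m U ^+ m]exprD subnK // Un mul1mx.
suff gramE a b : gram_mx a b = (x^t* *m (U ^+ subm a b *m x)) 0 0.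
  by rewrite !gramE eq_ij.
have -> : U ^+ subm a b = (U ^+ b)^t* *m U ^+ a.
  by rewrite UXC 1?ltnW // -[RHS]exprD addnC (expr_mod _ Un).
rewrite gram_mxE !rE dotmx_colE trmx_mul map_mxM.
by rewrite -!mulmxA.
Qed.
End Gram.

Lemma expr_diag_mx (K : pzRingType) n (d : 'rV[K]_n) m :
  diag_mx d ^+ m = diag_mx (map_mx (fun a => a ^+ m) d).
Proof.
elim: m => [|m IHm].
  rewrite (_ : map_mx _ d = const_mx 1) ?diag_const_mx //.
  by apply/rowP=> i; rewrite !mxE.
rewrite exprS IHm [_ * _]mulmx_diag; congr diag_mx.
by apply/rowP=> i; rewrite !mxE exprS.
Qed.

(** Row [i] of [F sqrt(D)] has entries [w^(i m) sqrt(d_m)]: it is the image of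
    the vector [sqrt(d)] under the [i]-th power of [diag(w^m)]. *)
Lemma cyclic_gram_fourier_diag (R : realType) n (w : R[i]) (d : 'rV_n) :
    n.-primitive_root w -> (forall m, 0 <= d 0 m) ->
  exists2 r : 'I_n -> 'cV[R[i]]_n, cyclically_symmetric r &
    gram_mx r = fourier n w *m diag_mx d *m (fourier n w)^t*.
Proof.
move=> w_prim d_ge0; pose U := diag_mx (\row_(m < n) w ^+ m).
pose x : 'cV_n := (map_mx sqrtC d)^T; exists (fun i => U ^+ i *m x); last first.
  rewrite fourier_diag_gram // /gram_mx.
  suff -> : \matrix_(i < n) (U ^+ i *m x)^T =
            fourier n w *m diag_mx (map_mx sqrtC d) by [].
  apply/matrixP=> i m; rewrite 2![LHS]mxE /U expr_diag_mx mul_mx_diag mul_diag_mx.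
  by rewrite !mxE -exprM mulnC.
exists U, x; split=> //.
  apply/unitarymxP; rewrite tr_diag_mx map_diag_mx mulmx_diag.
  rewrite -diag_const_mx; congr diag_mx; apply/rowP=> m; rewrite !mxE.
  by rewrite [X in _ * X]rmorphXn /= -exprMn (prim_root_mul_conj w_prim) expr1n.
rewrite /U expr_diag_mx -diag_const_mx; congr diag_mx; apply/rowP=> m; rewrite !mxE.
by rewrite exprAC (prim_expr_order w_prim) expr1n.
Qed.

(** * Powers of omega *)

Section Omega.
Variables (R : realType) (n : nat).

Lemma omegaX m : omega R n ^+ m =
  Complex (cos (2 * pi / n%:R *+ m)) (sin (2 * pi / n%:R *+ m)).
Proof.
elim: m => [|m IHm]; first by rewrite expr0 mulr0n cos0 sin0.
rewrite exprSr IHm ![_ *+ m.+1]mulrSr cosD sinD /omega.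
by apply/eqP; rewrite eq_complex /= eqxx addrC eqxx.
Qed.

(** For [0 < m < n], put [t = m pi / n]. The real part of [omega^m] is
    [cos (2 t) = 1 - 2 (sin t)^2], which is below 1 because [0 < t < pi]. *)
Lemma omega_prim_root : (0 < n)%N -> n.-primitive_root (omega R n).
Proof.
move=> n_gt0; have n0 : n%:R != 0 :> R by rewrite pnatr_eq0 -lt0n.
rewrite /primitive_root_of_unity n_gt0; apply/forallP => i.
rewrite unity_rootE omegaX eqn_leq ltn_ord /=.
case: ltnP => [lt_in|le_ni].
  rewrite eq_complex /=; apply/eqP/negbTE.
  rewrite negb_and; apply/orP; left.
  pose t : R := pi / n%:R *+ i.+1.
  have -> : 2 * pi / n%:R *+ i.+1 = t *+ 2.
    by rewrite /t mulrnAC -mulrA mulr_natl.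
  have t_range : 0 < t < pi.
    rewrite /t -mulr_natr mulr_gt0 ?divr_gt0 ?pi_gt0 ?ltr0n //=.
    by rewrite mulrAC ltr_pdivrMr ?ltr0n // ltr_pM2l ?pi_gt0 // ltr_nat.
  have sint := sin_gt0_pi t_range.
  rewrite lt_eqF // cos_mulr2n cos2sin2 ltrBlDr -[1 + 1]mulr2n ltr_pMn2r //.
  by rewrite gtrBl exprn_gt0.
have -> : i.+1 = n by apply/eqP; rewrite eqn_leq ltn_ord.
by rewrite -mulr_natr divfK // mulr_natl cos2pi sin2pi eqxx.
Qed.
End Omega.

(** * Nonnegative polynomials and circulant matrices *)

Section Polynomials.
Variables (R : realType) (n : nat).
Hypothesis n_gt0 : (0 < n)%N.
Implicit Types p : {poly R}.
Local Notation C := R[i].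
Local Notation w := (omega R n).
Local Notation F := (fourier n w).

Lemma nb_termsE p : (size p <= n)%N -> nb_terms p = #|[set i : 'I_n | p`_i != 0]|.
Proof.
move=> le_pn; rewrite /nb_terms -!sum1dep_card.
rewrite (big_ord_widen_cond n (fun i => p`_i != 0) (fun=> 1%N)) //.
apply: eq_bigl => i; case: ltnP => [|le_pi]; first by rewrite andbT.
by rewrite andbF nth_default ?eqxx.
Qed.

(** The remainder of [p] modulo [z^n - 1], given by its coefficients so that
    their signs can be read off. *)
Definition fold_poly p : {poly R} :=
  \poly_(i < n) \sum_(m < size p | (m %% n)%N == i) p`_m.

Lemma size_fold_poly p : (size (fold_poly p) <= n)%N.
Proof. exact: size_poly. Qed.

Lemma fold_poly_nneg p : p \is a polyOver Num.nneg ->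
  fold_poly p \is a polyOver Num.nneg.
Proof.
move=> /polyOverP p0; apply/polyOverP => i; rewrite coef_poly.
by case: ltnP => _; rewrite ?rpred0 // rpred_sum.
Qed.

Lemma fold_poly_id p : (size p <= n)%N -> fold_poly p = p.
Proof.
move=> le_pn; apply/polyP => i; rewrite coef_poly; case: ltnP => [lt_in|le_ni].
  have [lt_ip|le_pi] := ltnP i (size p).
    rewrite (bigD1 (Ordinal lt_ip)) /= ?modn_small // big1 ?addr0 // => m.
    case/andP=> /eqP mi; rewrite -val_eqE /= -mi modn_small ?eqxx //.
    exact: leq_trans le_pn.
  rewrite nth_default // big1 // => m /eqP mi; move: (ltn_ord m).
  rewrite -(modn_small (leq_trans (ltn_ord m) le_pn)) mi ltnNge le_pi.
  by [].
by rewrite nth_default // (leq_trans le_pn).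
Qed.

Lemma cevalE p z m : (size p <= m)%N ->
  ceval p z = \sum_(i < m) real_complex R p`_i * z ^+ i.
Proof.
move=> le_pm; rewrite /ceval (@horner_coef_wide _ m) ?size_map_poly //.
by apply: eq_bigr => i _; rewrite coef_map.
Qed.

Lemma ceval_fold p z : z ^+ n = 1 -> ceval (fold_poly p) z = ceval p z.
Proof.
move=> zn; rewrite (cevalE _ (size_fold_poly p)) (cevalE _ (leqnn _)).
rewrite (partition_big (fun m : 'I_(size p) => Ordinal (ltn_pmod m n_gt0)) xpredT) //=.
apply: eq_bigr => i _; rewrite coef_poly ltn_ord rmorph_sum mulr_suml.
by apply: eq_big => [m|m /eqP <-]; rewrite -?val_eqE //= (expr_mod _ zn).
Qed.

(** Nonnegativity is what makes the two counts agree: the square root of a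
    negative coefficient would be 0. *)
Lemma support_fold p : p \is a polyOver Num.nneg ->
  support_size (normalized_coef n p) = nb_terms (fold_poly p).
Proof.
move=> /fold_poly_nneg/polyOverP p0.
rewrite nb_termsE ?size_fold_poly // /support_size.
apply: eq_card => i; rewrite !inE mxE; have := p0 i.
by rewrite coef_poly ltn_ord nnegrE => b0; rewrite sqrtr_eq0 -ltNge lt_def b0 andbT.
Qed.

Definition coef_row p : 'rV[C]_n := \row_i real_complex R p`_i.

Lemma fourier_diag_coef p i j : (size p <= n)%N ->
  (F *m diag_mx (coef_row p) *m F^t*) i j = ceval p (w ^+ subm i j).
Proof.
move=> le_pn; rewrite (fourier_diagE (omega_prim_root R n_gt0)) (cevalE _ le_pn).
by apply: eq_bigr => m _; rewrite mxE -exprM mulnC.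
Qed.

(** The eigenvalues of [A] are the coefficients of the polynomial, and they are
    real because they are nonnegative. *)
Lemma psd_circulant_polyP (A : 'M[C]_n) :
  psd A /\ circulant A <->
  exists p, [/\ p \is a polyOver Num.nneg, (size p <= n)%N
              & A = F *m diag_mx (coef_row p) *m F^t*].
Proof.
have w_prim := omega_prim_root R n_gt0; split.
  case=> psdA /(psd_circulant_spectral w_prim psdA)[d d0 ->].
  exists (\poly_(i < n) complex.Re (d 0 (insubd (Ordinal n_gt0) i))); split.
  - apply/polyOverP=> i; rewrite coef_poly; case: ltnP => _; last exact: rpred0.
    by have := d0 (insubd (Ordinal n_gt0) i); rewrite lecE => /andP[].
  - exact: size_poly.
  congr (_ *m diag_mx _ *m _); apply/rowP=> i.
  by rewrite mxE coef_poly ltn_ord valKd RRe_real ?ger0_real.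
move=> [p [/polyOverP p0 le_pn ->]]; split; last exact: circulant_fourier_diag.
rewrite fourier_diag_gram; first exact: psd_gram.
by move=> m; rewrite mxE ler0c; exact: p0.
Qed.

Lemma rank_fourier_diag_coef p : (size p <= n)%N ->
  \rank (F *m diag_mx (coef_row p) *m F^t*) = nb_terms p.
Proof.
move=> le_pn; rewrite (rank_fourier_diag (omega_prim_root R n_gt0)) nb_termsE //.
by apply: eq_card => i; rewrite !inE mxE fmorph_eq0.
Qed.

(** The residues [1, ..., n - 1] are exactly the differences of two distinct
    vertices, each residue [j] being realized by the vertices [j] and [0]. *)
Lemma has_graph_ceval (S : {pred nat}) p (A : 'M[C]_n) :
    A \is hermsymmx -> (forall i j, A i j = ceval p (w ^+ subm i j)) ->
  has_graph A (circ n S) <->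
  forall j : nat, (1 <= j <= n - 1)%N -> ceval p (w ^+ j) = 0 <-> j \notin S.
Proof.
move=> hA AE.
have lt_pred j : (1 <= j <= n - 1)%N = (0 < j < n)%N.
  by rewrite subn1 -[(j <= _)%N]ltnS prednK.
split=> [[_ gA] j|pS].
  rewrite lt_pred => /andP[j_gt0 lt_jn].
  have /gA : Ordinal lt_jn != Ordinal n_gt0 by rewrite -val_eqE /= -lt0n.
  rewrite AE /circ; have -> : subm (Ordinal lt_jn) (Ordinal n_gt0) = j.
    by rewrite /subm /= subn0 modnDr modn_small.
  case=> h1 h2; split=> [e|]; last first.
    by move=> jS; apply/eqP; apply: contraNT jS; exact: h1.
  by apply/negP=> /h2; rewrite e eqxx.
split=> // i j ne_ij; rewrite AE /circ.
have /pS : (1 <= subm i j <= n - 1)%N.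
  rewrite lt_pred ltn_mod n_gt0 andbT lt0n; apply: contra ne_ij => /eqP e.
  rewrite -val_eqE /= -(modn_small (ltn_ord i)) -(modn_small (ltn_ord j)).
  rewrite -(eqn_modDr (n - j)) subnKC 1?ltnW // modnn.
  by rewrite -/(subm i j) e.
case=> h1 h2; split=> [ne0|ijS].
  by apply: contraNT ne0 => /h2 ->.
by apply/eqP=> /h1; rewrite ijS.
Qed.

End Polynomials.

(** * The equivalence *)

Theorem theorem4p7 (R : realType) (n : nat) (S : {pred nat}) (k : nat)
    (n_gt0 : (0 < n)%N)
    (S_sub : forall s : nat, s \in S -> (1 <= s <= n - 1)%N)
    (S_opp : forall s : nat, s \in S -> ((n - s) %% n)%N \in S) :
  [<->
    exists A : 'M[R[i]]_n,
      [/\ psd A, circulant A, \rank A = k & has_graph A (circ n S)];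

    exists (d : nat) (r : 'I_n -> 'cV[R[i]]_d),
      [/\ orthorep (circ n S) r, cyclically_symmetric r & orthorep_rank r = k];

    exists p : {poly R},
      [/\ p \is a polyOver Num.nneg,
          support_size (normalized_coef n p) = k
        & forall j : nat, (1 <= j <= n - 1)%N ->
            (ceval p (omega R n ^+ j) = 0 <-> j \notin S)];

    exists p : {poly R},
      [/\ p \is a polyOver Num.nneg, (size p <= n)%N, nb_terms p = k
        & forall j : nat, (1 <= j <= n - 1)%N ->
            (ceval p (omega R n ^+ j) = 0 <-> j \notin S)]].
Proof.
have w_prim := omega_prim_root R n_gt0.
tfae.
- move=> [A [psdA circA rkA gA]].
  have [d d_ge0 defA] := psd_circulant_spectral w_prim psdA circA.
  have [r cr gr] := cyclic_gram_fourier_diag w_prim d_ge0.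
  exists n, r; split=> //; first by apply/orthorep_gramP; rewrite gr -defA.
  by rewrite -rank_gram_mx gr -defA.
- move=> [d [r [re cr rk]]].
  have psdA := gram_mx_psd r; have circA := circulant_gram_mx cr.
  have [p [p0 le_pn defA]] := (psd_circulant_polyP n_gt0 _).1 (conj psdA circA).
  exists p; split=> //.
    rewrite support_fold // fold_poly_id // -(rank_fourier_diag_coef n_gt0 le_pn).
    by rewrite -defA rank_gram_mx.
  apply/(has_graph_ceval n_gt0 S psdA.1); last exact/orthorep_gramP.
  by move=> i j; rewrite defA fourier_diag_coef.
- move=> [p [p0 supp pS]]; exists (fold_poly n p); split.
  + exact: fold_poly_nneg.
  + exact: size_fold_poly.
  + by rewrite -support_fold.
  move=> j /pS; rewrite ceval_fold // exprAC (prim_expr_order w_prim).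
  exact: expr1n.
move=> [p [p0 le_pn nt pS]].
have [psdA circA] := (psd_circulant_polyP n_gt0 _).2
  (ex_intro _ p (And3 p0 le_pn erefl)).
exists (fourier n (omega R n) *m diag_mx (coef_row n p) *m (fourier n (omega R n))^t*).
split=> //; first by rewrite rank_fourier_diag_coef.
apply/(has_graph_ceval n_gt0 S psdA.1); last exact: pS.
by move=> i j; rewrite fourier_diag_coef.
Qed.
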